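(* Let $C>0$ be given and suppose the following assumptions hold. (A1): there exist class-$\mathcal{K}_\infty$ functions $\underline{\eta},\overline{\eta}$ with $\underline{\eta}(|x-\bar x|)\le \ell^{\star}(x)\le\overline{\eta}(|x-\bar x|)$ for all $x\in X$. (A2): there exist $\gamma\in\mathbb{R}_{>0}$ and a neighbourhood $\mathcal{N}$ of $\bar x$ such that $V_\infty(x)\le\gamma\,\ell^{\star}(x)$ for all $x\in\mathcal{N}\cap X$. Let $M:=\inf_{x\in X\setminus\mathcal{N}}\ell^{\star}(x)$ and $\beta:=\max\{C/M,\gamma\}$. Let $\delta\in(0,\beta)$ and $N\in\mathbb{N}$, set $T:=N\delta$, and suppose (A3): there exists $\bar C\in\mathbb{R}_{>0}$ such that for all $\delta'\in(0,T]$: $\delta'\,\ell^{\star}(\hat x)\le\bar C\,V_{\delta'}(\hat x)$ for all $\hat x\in V_T^{-1}[0,C]$. If \[ \max\Big\{\frac{C}{M\delta},\ \bar C\Big(\frac{\beta}{\delta}\Big)^2\Big\}\cdot\Big(\frac{\beta}{\beta+\delta}\Big)^{N-1}<1, \] then, with $\alpha:=\bar C(\beta/\delta)^2\big(\beta/(\beta+\delta)\big)^{N-1}$, for every $\hat x\in V_T^{-1}[0,C]$ and every minimiser $u^\star\in\mathcal{U}_T(\hat x)$ of $J_T(\hat x,\cdot)$, \[ V_T\big(x(\delta;\hat x,u^\star)\big)\le V_T(\hat x)-(1-\alpha)\int_0^\delta \ell\big(x(s;\hat x,u^\star),u^\star(s)\big)\,\mathrm{d}s. \]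
   Context: Consider the control system $\dot x(t)=f(x(t),u(t))$, $x(0)=x_0$, with $f:\mathbb{R}^n\times\mathbb{R}^m\to\mathbb{R}^n$ continuous and locally Lipschitz in its first argument on $\mathbb{R}^n\setminus\{0\}$; for $u\in L^\infty_{\mathrm{loc}}(\mathbb{R}_{\ge0},\mathbb{R}^m)$ the unique (maximal) solution is denoted $x(t;x_0,u)$. A set $\mathcal{E}\subseteq\mathbb{R}^n\times\mathbb{R}^m$ defines the constraints $(x(t),u(t))\in\mathcal{E}$. Let $U(x):=\{u\in\mathbb{R}^m:(x,u)\in\mathcal{E}\}$ and $X:=\{x: U(x)\neq\emptyset\}$. For $x_0\in X$ and $T>0$, $\mathcal{U}_T(x_0)$ is the set of $u\in L^\infty_{\mathrm{loc}}(\mathbb{R}_{\ge0},\mathbb{R}^m)$ such that the solution exists and satisfies $(x(t;x_0,u),u(t))\in\mathcal{E}$ on $[0,T]$; $\mathcal{U}_\infty(x_0)$ is defined analogously for all $t\ge0$. The stage cost $\ell:\mathbb{R}^n\times\mathbb{R}^m\to\mathbb{R}_{\ge0}$ is continuous; $J_T(x_0,u):=\int_0^T\ell(x(s;x_0,u),u(s))\,\mathrm{d}s$, $V_T(x_0):=\inf_{u\in\mathcal{U}_T(x_0)}J_T(x_0,u)$ (with $V_T(x_0)=+\infty$ if $\mathcal{U}_T(x_0)=\emptyset$), and $V_\infty$ is defined analogously over $\mathcal{U}_\infty(x_0)$ with the integral over $[0,\infty)$. $V_T^{-1}[0,C]:=\{x\in X: V_T(x)\le C\}$. $\ell^{\star}(x):=\inf_{u\in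 U(x)}\ell(x,u)$. The point $\bar x\in X$ is a controlled equilibrium: there is $\bar u\in U(\bar x)$ with $f(\bar x,\bar u)=0$. It is a standing assumption that whenever $\mathcal{U}_T(x_0)\neq\emptyset$, a minimiser of $J_T(x_0,\cdot)$ over $\mathcal{U}_T(x_0)$ exists. (In the MPC scheme with sampling time $\delta$ and horizon $T=N\delta$, such a minimiser $u^\star$ for the measured state $\hat x$ is applied on $[0,\delta)$, so $x(\delta;\hat x,u^\star)$ is the next closed-loop state.) *)

(* Defs.v *)
From HB Require Import structures.
From mathcomp Require Import all_boot all_order all_algebra.
From mathcomp Require Import all_classical all_reals all_analysis.
Set Implicit Arguments. Unset Strict Implicit. Unset Printing Implicit Defensive.
Import Order.TTheory GRing.Theory Num.Theory.
Import numFieldNormedType.Exports.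
Local Open Scope classical_set_scope.
Local Open Scope ring_scope.

Section MPC.
Context {R : realType} {n m : nat}.
Local Notation St := 'rV[R]_n.
Local Notation In := 'rV[R]_m.
Local Notation mu := (@lebesgue_measure R).

Definition Linf_loc (u : R -> In) : Prop :=
  (forall j : 'I_m, measurable_fun (`[0%R, +oo[%classic : set R) (fun t => u t ord0 j)) /\
  (forall T : R, 0 < T ->
     exists b : R, {ae mu, forall t, (`[0%R, T]%classic : set R) t -> `|u t| <= b}).

(** x is a (Carathéodory) solution of x' = f(x,u), x(0) = x0, on [0,T]. *)
Definition is_sol (f : St -> In -> St) (x0 : St) (u : R -> In) (T : R)
    (x : R -> St) : Prop :=
  {within (`[0%R, T]%classic : set R), continuous x} /\
  forall t, 0 <= t <= T ->
    x t = x0 + \row_(i < n) (\int[mu]_(s in (`[0%R, t]%classic : set R)) f (x s) (u s) ord0 i).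

Definition Uset (E : St -> In -> Prop) (x : St) : set In := [set v | E x v].
Definition Xset (E : St -> In -> Prop) : set St := [set x | exists v, E x v].

Definition admissible (f : St -> In -> St) (E : St -> In -> Prop) (x0 : St)
    (T : R) (u : R -> In) (x : R -> St) : Prop :=
  Linf_loc u /\ is_sol f x0 u T x /\ (forall t, 0 <= t <= T -> E (x t) (u t)).

Definition admissible_inf (f : St -> In -> St) (E : St -> In -> Prop) (x0 : St)
    (u : R -> In) (x : R -> St) : Prop :=
  Linf_loc u /\ (forall T, 0 < T -> is_sol f x0 u T x) /\
  (forall t, 0 <= t -> E (x t) (u t)).

Definition JT (l : St -> In -> R) (T : R) (u : R -> In) (x : R -> St) : \bar R :=
  (\int[mu]_(s in (`[0%R, T]%classic : set R)) (l (x s) (u s))%:E)%E.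

Definition Jinf (l : St -> In -> R) (u : R -> In) (x : R -> St) : \bar R :=
  (\int[mu]_(s in (`[0%R, +oo[%classic : set R)) (l (x s) (u s))%:E)%E.

(** V_T (= +oo if U_T(x0) is empty) *)
Definition VT (f : St -> In -> St) (E : St -> In -> Prop) (l : St -> In -> R) (T : R) (x0 : St) : \bar R :=
  ereal_inf [set e | exists (u : R -> In) (x : R -> St),
    admissible f E x0 T u x /\ e = JT l T u x].

Definition Vinf (f : St -> In -> St) (E : St -> In -> Prop) (l : St -> In -> R) (x0 : St) : \bar R :=
  ereal_inf [set e | exists (u : R -> In) (x : R -> St),
    admissible_inf f E x0 u x /\ e = Jinf l u x].

Definition lstar (E : St -> In -> Prop) (l : St -> In -> R) (x : St) : R :=
  inf [set l x v | v in Uset E x].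

End MPC.

Definition Kinf {R : realType} (eta : R -> R) : Prop :=
  {within (`[0%R, +oo[%classic : set R), continuous eta} /\ eta 0 = 0 /\
  (forall a b : R, 0 <= a -> a < b -> eta a < eta b) /\
  (forall K : R, exists r : R, forall s, r <= s -> K <= eta s).

(* Main.v *)
Require Import Defs.
From HB Require Import structures.
From mathcomp Require Import all_boot all_order all_algebra.
From mathcomp Require Import all_classical all_reals all_analysis.
From mathcomp Require Import measurable_realfun ring lra.
Import Order.TTheory GRing.Theory Num.Theory.
Import numFieldNormedType.Exports.
Local Open Scope classical_set_scope.
Local Open Scope ring_scope.

(** Along an optimal trajectory the remaining cost B(t) = V_T(xh) - J_t satisfies
B(t) <= beta * lstar(x(t)) by the principle of optimality: inside the neighbourhood this is
cost controllability (A2), and outside of it B(t) <= C <= (C/M) * lstar(x(t)). Choosing in an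
interval of length delta a time at which the running cost is at most its mean gives
B(t + delta) <= beta/(beta + delta) * B(t). Hence on the last sampling interval there is a time
s with delta * lstar(x(s)) <= (beta/(beta + delta))^(N-1) * V_T(xh), so that x(s) lies in the
neighbourhood; following the optimal trajectory from delta to s and then continuing from
x(s) at cost at most gamma * lstar(x(s)) gives the claim, (A3) turning V_T(xh) into a
multiple of the cost on [0, delta]. *)

(** * Measurability and translations *)

(** Measurability of [x] and [u] is expressed through coordinates, so the preimage of an open
    interval under [h] has to be described by countably many coordinate conditions. *)
Lemma measurable_fun_continuous2 {d} {T : measurableType d} {R : realType}
    {n m : nat} (D : set T) (x : T -> 'rV[R]_n) (u : T -> 'rV[R]_m)
    (h : 'rV[R]_n -> 'rV[R]_m -> R) :
  continuous (fun p : 'rV[R]_n * 'rV[R]_m => h p.1 p.2) ->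
  (forall i, measurable_fun D (fun t => x t ord0 i)) ->
  (forall j, measurable_fun D (fun t => u t ord0 j)) ->
  measurable_fun D (fun t => h (x t) (u t)).
Proof.
move=> ch mx mu mD.
apply: (measurability _ (RGenOpens.measurableE R)) => //.
move=> _ [_ [a [b ->] <-]].
pose O : set ('rV[R]_n * 'rV[R]_m) := (fun p => h p.1 p.2) @^-1` `]a, b[.
have oO : open O.
  by move/continuousP : ch; apply; exact: interval_open.
(* O is the countable union of the rational boxes that it contains. *)
pose box (c : 'rV[rat]_n * 'rV[rat]_m * nat) :
    set ('rV[R]_n * 'rV[R]_m) :=
  [set p : 'rV[R]_n * 'rV[R]_m |
           (forall i, `|p.1 ord0 i - ratr (c.1.1 ord0 i)| < c.2.+1%:R^-1) /\
           (forall j, `|p.2 ord0 j - ratr (c.1.2 ord0 j)| < c.2.+1%:R^-1)].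
have mbox c : measurable (D `&` [set t | box c (x t, u t)]).
  have mcoord k (w : T -> 'rV[R]_k) (q : 'rV[rat]_k) (e : R) :
      (forall i, measurable_fun D (fun t => w t ord0 i)) ->
      measurable (D `&` [set t | forall i, `|w t ord0 i - ratr (q ord0 i)| < e]).
    move=> mw.
    have -> : D `&` [set t | forall i, `|w t ord0 i - ratr (q ord0 i)| < e] =
       D `&` \bigcap_(i in [set: 'I_k])
         (D `&` (fun t => w t ord0 i) @^-1` `]ratr (q ord0 i) - e, ratr (q ord0 i) + e[).
      apply/seteqP; split=> t /= [Dt H]; split=> // i.
        by move=> _; split => //=; rewrite in_itv/= -ltr_distl.
      by have [_ /=] := H i I; rewrite in_itv/= -ltr_distl.
    apply: measurableI => //; apply: fin_bigcap_measurable => // i _.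
    exact: mw.
  rewrite (_ : [set t | _] =
     [set t | forall i, `|x t ord0 i - ratr (c.1.1 ord0 i)| < c.2.+1%:R^-1] `&`
     [set t | forall i, `|u t ord0 i - ratr (c.1.2 ord0 i)| < c.2.+1%:R^-1]) //.
  by rewrite -[D in D `&` _]setIid setIACA; apply: measurableI; exact: mcoord.
have -> : D `&` (fun t => h (x t) (u t)) @^-1` `]a, b[ =
    \bigcup_c (if `[< box c `<=` O >] then D `&` [set t | box c (x t, u t)] else set0).
  apply/seteqP; split=> [t [Dt Ht]|t [c _]]; last first.
    case: ifPn => [/asboolP bO [Dt] /bO Ht|//]; split=> //.
  have Ot : O (x t, u t) by [].
  have /nbhs_ballP[e /= e0 eO] := open_nbhs_nbhs (conj oO Ot).
  (* Two points within [1/(k+1) < e/2] of the same rational are less than [e] apart, so the box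
     chosen below stays inside the ball contained in [O]. *)
  have [k] := ltr_add_invr (divr_gt0 e0 (ltr0Sn R 1)); rewrite add0r => ke.
  have q_ex (y : R) : {q : rat | `|y - ratr q| < k.+1%:R^-1}.
    apply: cid.
    have /rat_in_itvoo[q] : y - k.+1%:R^-1 < y + k.+1%:R^-1.
      by rewrite ltrD2l gtrN.
    by rewrite in_itv/= -ltr_distl => qy; exists q; rewrite distrC.
  exists (\row_i sval (q_ex (x t ord0 i)), \row_j sval (q_ex (u t ord0 j)), k) => //.
  rewrite ifT.
    split => //; split => i /=; rewrite mxE; exact: (svalP (q_ex _)).
  apply/asboolP => -[y v] [/= Hy Hv]; apply: eO.
  have near (s s' : R) (q : rat) :
      `|s - ratr q| < k.+1%:R^-1 -> `|s' - ratr q| < k.+1%:R^-1 -> `|s - s'| < e.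
    move=> H1 H2; rewrite -(subrKA (ratr q)) (le_lt_trans (ler_normD _ _))//.
    rewrite (splitr e) ltrD// ?(lt_trans H1)//.
    by rewrite distrC (lt_trans H2).
  split; split => // i j; rewrite (ord1 i) /ball/=.
    by apply: near (Hy j); rewrite mxE; exact: (svalP (q_ex _)).
  by apply: near (Hv j); rewrite mxE; exact: (svalP (q_ex _)).
apply: countable_bigcupT_measurable => [|c]; first exact: countableP.
by case: ifP.
Qed.

Section shift.
Set Implicit Arguments.
Unset Strict Implicit.
Context {R : realType}.
Local Notation mu := (@lebesgue_measure R).

Lemma measurable_shift (a : R) : measurable_fun setT (fun s : R => s + a).
Proof. by apply: continuous_measurable_fun => s; exact: cvgD (cvg_id) (cvg_cst _). Qed.

Lemma preimage_shift_itvcc (a b c : R) :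
  (fun s : R => s + a) @^-1` `[b + a, c + a]%classic = `[b, c]%classic.
Proof. by apply/seteqP; split=> s /=; rewrite !in_itv/= !lerD2r. Qed.

(** The pushforward under a translation gives every half-open interval its length, and Lebesgue
    measure is the only measure that does so. *)
Lemma lebesgue_measure_shift (a : R) (A : set R) : measurable A ->
  pushforward mu (fun s : R => s + a : measurableTypeR R) A = mu A.
Proof.
move=> mA.
pose phi : measurableTypeR R -> measurableTypeR R := fun s => s + a.
pose mphi := isMeasurableFun.Build _ _
  (measurableTypeR R) (measurableTypeR R) phi (measurable_shift a).
pose mp : {mfun measurableTypeR R >-> measurableTypeR R} := HB.pack phi mphi.
apply/esym/(@lebesgue_measure_unique _ (pushforward mu mp)) => // _ [[b c]] _ <-.
transitivity (mu `]b - a, c - a]%classic).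
  rewrite !lebesgue_measure_itv/= !lte_fin ltrD2r.
  by case: ifP => // _; rewrite -!EFinB opprB subrKA.
congr (mu _); apply/seteqP.
by split=> s /=; rewrite !in_itv/= ltrBlDr lerBrDr.
Qed.

Lemma integral_shift (a : R) (D : set R) (g : R -> \bar R) :
  measurable D -> measurable_fun D g ->
  (\int[mu]_(s in D) g s =
   \int[mu]_(s in (fun s => (s + a)%R) @^-1` D) g (s + a)%R)%E.
Proof.
move=> mD mg.
have ge0_shift (k : R -> \bar R) : measurable_fun D k -> (forall s, 0 <= k s)%E ->
    (\int[mu]_(s in D) k s =
     \int[mu]_(s in (fun s => (s + a)%R) @^-1` D) k (s + a)%R)%E.
  move=> mk k0.
  rewrite -(@ge0_integral_pushforward _ _ (measurableTypeR R) (measurableTypeR R) R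
    (fun s => s + a) (measurable_shift a) mu D k mD mk); last first.
    by move=> s _; exact: k0.
  apply: eq_measure_integral => [|mphi A mA _]; first exact: measurable_shift.
  exact/esym/lebesgue_measure_shift.
rewrite integralE [RHS]integralE.
congr (_ - _)%E.
  rewrite (ge0_shift _ (measurable_funepos mg) (funepos_ge0 g)).
  by apply: eq_integral => s _; rewrite !funeposE.
rewrite (ge0_shift _ (measurable_funeneg mg) (funeneg_ge0 g)).
by apply: eq_integral => s _; rewrite !funenegE.
Qed.

Lemma negligible_shift (a : R) (A : set R) :
  mu.-negligible A -> mu.-negligible ((fun s => s + a) @^-1` A).
Proof.
move=> [B [mB B0 AB]]; exists ((fun s => s + a) @^-1` B); split.
- by rewrite -[X in measurable X]setTI; exact: measurable_shift.
- by rewrite -B0 -[RHS](lebesgue_measure_shift a).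
- by move=> s /= /AB.
Qed.

Lemma itv_shift_setU (a b : R) : 0 <= a -> 0 <= b ->
  `[0, a + b]%classic = `[0, a[%classic `|` `[a, a + b]%classic.
Proof.
by move=> a0 b0; rewrite -itv_bndbnd_setU// bnd_simp// lerDl.
Qed.

Lemma integral_itv_add (a b : R) (g : R -> \bar R) : 0 <= a -> 0 <= b ->
  measurable_fun `[0, a + b]%classic g ->
  (\int[mu]_(s in `[0%R, (a + b)%R]%classic) g s =
   \int[mu]_(s in `[0%R, a]%classic) g s +
   \int[mu]_(s in `[0%R, b]%classic) g (s + a)%R)%E.
Proof.
move=> a0 b0 mg.
rewrite itv_shift_setU// integral_setU//; last 2 first.
- by rewrite -itv_shift_setU.
- by apply/disj_setPS => s [/=]; rewrite !in_itv/= => /andP[_ sa] /andP[]; rewrite leNgt sa.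
(* The union has to be disjoint, so the first piece is half-open; adding its endpoint back leaves
   the integral unchanged. *)
rewrite integral_itv_bndo_bndc; last first.
  by apply: measurable_funS mg => //; apply: subset_itvl; rewrite bnd_simp lerDl.
congr (_ + _)%E.
rewrite [LHS](integral_shift a)//; last first.
  by apply: measurable_funS mg => //; apply: subset_itvr; rewrite bnd_simp.
by rewrite -[X in `[X, _]]add0r [a + b]addrC preimage_shift_itvcc.
Qed.

End shift.

(** * State-input trajectories *)

Section control_system.
Set Implicit Arguments.
Unset Strict Implicit.
Context {R : realType} {n m : nat}.
Local Notation mu := (@lebesgue_measure R).
Implicit Types (x y : R -> 'rV[R]_n) (u v : R -> 'rV[R]_m) (z : 'rV[R]_n).
Implicit Types (f : 'rV[R]_n -> 'rV[R]_m -> 'rV[R]_n) (T : R).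

Lemma measurable_coord_within x (D : set R) i : measurable D ->
  {within D, continuous x} -> measurable_fun D (fun t => x t ord0 i).
Proof.
move=> mD cx; apply: subspace_continuous_measurable_fun => // t.
exact: (continuous_comp (cx t) (@coord_continuous _ _ _ _ _ _)).
Qed.

Lemma Linf_loc_measurable u (D : set R) j : Linf_loc u -> measurable D ->
  D `<=` `[0, +oo[%classic -> measurable_fun D (fun t => u t ord0 j).
Proof. by move=> [mu_ _] mD DT; exact: measurable_funS (mu_ j). Qed.

Lemma measurable_fun_state_input (h : 'rV[R]_n -> 'rV[R]_m -> R) x u (T : R) :
  continuous (fun p : 'rV[R]_n * 'rV[R]_m => h p.1 p.2) ->
  Linf_loc u -> {within `[0, T]%classic, continuous x} ->
  measurable_fun `[0, T]%classic (fun t => h (x t) (u t)).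
Proof.
move=> ch lu cx; apply: measurable_fun_continuous2 => // i.
  exact: measurable_coord_within.
by apply: Linf_loc_measurable => //; apply: subset_itvl.
Qed.

(** The state is bounded on the compact interval and the input is essentially bounded, so almost
    every pair lies in a compact set [K], on which [h] is bounded. *)
Lemma integrable_state_input (h : 'rV[R]_n -> 'rV[R]_m -> R) x u (T : R) :
  continuous (fun p : 'rV[R]_n * 'rV[R]_m => h p.1 p.2) ->
  Linf_loc u -> {within `[0, T]%classic, continuous x} ->
  mu.-integrable `[0, T]%classic (EFin \o (fun t => h (x t) (u t))).
Proof.
move=> ch lu cx.
have mh := measurable_fun_state_input ch lu cx.
have mEh : measurable_fun `[0, T]%classic (EFin \o (fun t => h (x t) (u t))).
  exact/measurable_EFinP.
(* [Linf_loc] bounds inputs on positive horizons only, while [T] is arbitrary here. *)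
have [|b ub] := lu.2 (Num.max T 1); first by rewrite lt_max ltr01 orbT.
have /compact_bounded[a [_ xa]] :=
  continuous_compact cx (@segment_compact _ _ _).
pose K := [set w : 'rV[R]_n | `|w| <= a + 1] `*` [set w : 'rV[R]_m | `|w| <= b].
have cball k (r : R) : compact [set w : 'rV[R]_k | `|w| <= r].
  apply: bounded_closed_compact.
    by exists r; split=> [|r' rr' w /= /le_trans]; [exact: num_real|apply; exact: ltW].
  rewrite (_ : [set w : 'rV[R]_k | _] = (fun w => `|w|) @^-1` `]-oo, r]%classic).
    by apply: closed_comp => [w _|]; [exact: norm_continuous|exact: interval_closed].
  by apply/seteqP; split=> w /=; rewrite in_itv.
have /compact_bounded[c [_ hc]] : compact ((fun p => h p.1 p.2) @` K).
  apply: continuous_compact; first exact: continuous_subspaceT.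
  by apply: compact_setX; exact: cball.
apply/integrableP; split=> //.
apply: le_lt_trans.
  apply: (integral_le_bound (`|c| + 1)%:E) => //.
  have [N [mN N0 HN]] := ub.
  exists N; split=> // t /= nt; apply: HN => /= ut; apply: nt => t0T.
  rewrite lee_fin; apply: hc; first by rewrite (le_lt_trans (ler_norm c))// ltrDl.
  exists (x t, u t) => //; split => /=.
    by apply: xa; [rewrite ltrDl|exists t].
  by apply: ut; apply: subset_itvl t0T; rewrite bnd_simp le_max lexx.
have mu_fin : (mu `[0%R, T]%classic < +oo)%E.
  by rewrite lebesgue_measure_itv/=; case: ifP; rewrite ?ltry// -EFinB ltry.
by rewrite lte_mul_pinfty.
Qed.

Lemma within_continuous_comp x (A B : set R) (phi : R -> R) :
  continuous phi -> (forall s, A s -> B (phi s)) ->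
  {within B, continuous x} -> {within A, continuous (x \o phi)}.
Proof.
move=> cphi AB /subspace_continuousP cx; apply/subspace_continuousP => t At W.
move=> nW; have H : nbhs (phi t) [set s | B s -> W (x s)] := cx _ (AB _ At) W nW.
have Hphi : nbhs t [set s | B (phi s) -> W (x (phi s))] := cphi t _ H.
rewrite -[_ W]/(nbhs t [set s | A s -> W (x (phi s))]).
by apply: filterS Hphi => s /= Hs /AB.
Qed.

Lemma is_sol0 f z u T x : 0 <= T -> is_sol f z u T x -> x 0 = z.
Proof.
move=> T0 [_ /(_ 0)]; rewrite lexx T0 => /(_ isT) ->.
by apply/rowP => i; rewrite !mxE set_itv1 Rintegral_set1 addr0.
Qed.

Lemma is_solW f z u T T' x : T' <= T ->
  is_sol f z u T x -> is_sol f z u T' x.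
Proof.
move=> TT' [cx xE]; split=> [|t /andP[t0 tT']].
  by apply: continuous_subspaceW cx; apply: subset_itvl; rewrite bnd_simp.
by apply: xE; rewrite t0 (le_trans tT').
Qed.

Lemma Rintegral_itv_add (a b : R) (g : R -> R) : 0 <= a -> 0 <= b ->
  mu.-integrable `[0, a + b]%classic (EFin \o g) ->
  \int[mu]_(s in `[0, a + b]%classic) g s =
  \int[mu]_(s in `[0, a]%classic) g s +
  \int[mu]_(s in `[0, b]%classic) g (s + a).
Proof.
move=> a0 b0 ig; rewrite /Rintegral.
have mg : measurable_fun `[0, a + b]%classic (EFin \o g) by exact: measurable_int ig.
have gE := integral_itv_add a0 b0 mg.
have gfin : (\int[mu]_(s in `[0%R, (a + b)%R]%classic) (g s)%:E)%E \is a fin_num.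
  exact: integrable_fin_num.
move: gfin; rewrite gE fin_numD => /andP[fa fb].
by rewrite -fineD.
Qed.

Lemma Linf_loc_shift u (a : R) : 0 <= a -> Linf_loc u ->
  Linf_loc (fun s => u (s + a)).
Proof.
move=> a0 [mu_ bu]; split=> [j|T T0].
  apply: (measurable_comp _ _ (mu_ j)) => //.
    move=> _ [s + <-]; rewrite /= !in_itv/= !andbT => s0.
    by rewrite addr_ge0.
  exact: measurable_funTS (measurable_shift a).
have [b [N [mN N0 HN]]] := bu (T + a) (ltr_wpDr a0 T0); exists b.
have /(negligible_shift a) H : mu.-negligible N by exists N; split.
apply: negligibleS H => s /= Hs; apply: HN => /= Hb; apply: Hs => sT.
apply: Hb; move: sT; rewrite !in_itv/= => /andP[s0 sT].
by rewrite addr_ge0//= lerD2r.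
Qed.

(** Concatenation in which the second function restarts its clock at 0. The switching time belongs
    to the second piece: states agree there, but the input takes the value [v 0]. *)
Definition splice {V : Type} (t : R) (x y : R -> V) (s : R) : V :=
  if s < t then x s else y (s - t).

Lemma Linf_loc_splice u v (t : R) : 0 <= t -> Linf_loc u -> Linf_loc v ->
  Linf_loc (splice t u v).
Proof.
move=> t0 [mu_ bu] [mv bv]; split=> [j|T T0].
  rewrite (_ : (fun s => _) =
      (fun s => if s < t then u s ord0 j else v (s - t) ord0 j)); last first.
    by apply/funext => s; rewrite /splice; case: ifP.
  apply: measurable_fun_if => //.
  - by apply: measurable_funTS; apply: measurable_fun_ltr.
  - apply: measurable_funS (mu_ j) => //; exact: subIsetl.
  - apply: (measurable_comp _ _ (mv j)) => //.
      move=> _ [s [/= _ st] <-]; rewrite in_itv/= andbT subr_ge0 leNgt.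
      by apply/negPf.
    exact: measurable_funTS (measurable_shift (- t)).
have [bu' [N [mN N0 HN]]] := bu T T0.
have [bv' [M [mM M0 HM]]] := bv T T0.
exists (Num.max bu' bv').
have /(negligible_shift (- t)) HMt : mu.-negligible M by exists M; split.
have HNn  : mu.-negligible N by exists N; split.
apply: negligibleS (negligibleU HNn HMt) => s /= Hs.
have [st|ts] := ltP s t; [left; apply: HN|right; apply: HM] => /= Hb; apply: Hs;
    move=> sT; rewrite /splice.
  by rewrite st le_max Hb.
rewrite ltNge ts/= le_max Hb ?orbT// in_itv/= subr_ge0 ts/=.
move: sT; rewrite /= in_itv/= => /andP[_]; apply: le_trans.
by rewrite gerBl.
Qed.

End control_system.

(** * Shifted and concatenated solutions *)

Section trajectories.
Set Implicit Arguments.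
Unset Strict Implicit.
Context {R : realType} {n m : nat}.
Local Notation mu := (@lebesgue_measure R).
Variables (f : 'rV[R]_n -> 'rV[R]_m -> 'rV[R]_n) (E : 'rV[R]_n -> 'rV[R]_m -> Prop)
  (l : 'rV[R]_n -> 'rV[R]_m -> R).
Hypothesis f_cont : continuous (fun p : 'rV[R]_n * 'rV[R]_m => f p.1 p.2).
Hypothesis l_cont : continuous (fun p : 'rV[R]_n * 'rV[R]_m => l p.1 p.2).
Hypothesis l_ge0 : forall y v, 0 <= l y v.
Implicit Types (x y : R -> 'rV[R]_n) (u v : R -> 'rV[R]_m) (z : 'rV[R]_n) (a t T : R).

Lemma coord_f_cont i :
  continuous (fun p : 'rV[R]_n * 'rV[R]_m => f p.1 p.2 ord0 i).
Proof.
move=> p; apply: (@continuous_comp _ _ _ (fun p => f p.1 p.2)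
  (fun w : 'rV[R]_n => w ord0 i)); [exact: f_cont|exact: coord_continuous].
Qed.

Arguments coord_f_cont i : clear implicits.

(** Time invariance: the integral over [[0, a + t]] splits at [a], and its first part together with
    the initial value is [x a]. *)
Lemma is_sol_shift z u a T x : 0 <= a -> 0 <= T -> Linf_loc u ->
  is_sol f z u (a + T) x ->
  is_sol f (x a) (fun s => u (s + a)) T (fun s => x (s + a)).
Proof.
move=> a0 T0 lu [cx xE]; split=> [|t /andP[t0 tT]].
  apply: (@within_continuous_comp _ _ x _ `[0, a + T]%classic (fun s => s + a)) => //.
    by move=> s; exact: cvgD cvg_id (cvg_cst _).
  move=> s /=; rewrite !in_itv/= => /andP[s0 sT].
  by rewrite addr_ge0//= addrC lerD2l.
rewrite addrC xE ?addr_ge0 ?lerD2l// xE ?a0 ?lerDl//; apply/rowP => i.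
rewrite !mxE -addrA; congr (_ + _).
rewrite (Rintegral_itv_add (g := fun s => f (x s) (u s) ord0 i))//.
apply: integrableS (@integrable_state_input _ _ _ (fun w b => f w b ord0 i) _ _ _
  (coord_f_cont i) lu cx) => //.
by apply: subset_itvl; rewrite bnd_simp lerD2l.
Qed.

Lemma splice_shift {V : Type} a (w w' : R -> V) s : 0 <= s ->
  splice a w w' (s + a) = w' s.
Proof. by move=> s0; rewrite /splice ltNge lerDr s0/= addrK. Qed.

Lemma splice_le {V : Type} a (w w' : R -> V) s : w' 0 = w a -> s <= a ->
  splice a w w' s = w s.
Proof.
move=> ww'; rewrite le_eqVlt => /predU1P[->|]; rewrite /splice; last by move->.
by rewrite ltxx subrr.
Qed.

Lemma within_continuous_splice a T x y : 0 <= a -> 0 <= T -> y 0 = x a ->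
  {within `[0, a]%classic, continuous x} -> {within `[0, T]%classic, continuous y} ->
  {within `[0, a + T]%classic, continuous (splice a x y)}.
Proof.
move=> a0 T0 yx cx cy.
rewrite (_ : `[0, a + T]%classic = `[0, a]%classic `|` `[a, a + T]%classic); last first.
  apply/seteqP; split=> s /=; rewrite !in_itv/=.
    by case: (leP s a) => [sa /andP[->]|/ltW-> /andP[_ ->]]; [left|right].
  move=> [/andP[-> sa]|/andP[aS ->]]; rewrite ?andbT.
    by rewrite (le_trans sa)// lerDl.
  exact: le_trans aS.
apply: withinU_continuous; [exact: interval_closed|exact: interval_closed| |].
  apply: (@subspace_eq_continuous _ _ _ x) => // s.
  by rewrite inE/= in_itv/= => /andP[_ sa]; rewrite /from_subspace splice_le.
apply: (@subspace_eq_continuous _ _ _ (y \o (fun s => s - a))).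
  move=> s; rewrite inE/= in_itv/= => /andP[sa _].
  by rewrite /from_subspace -[in RHS](subrK a s) splice_shift ?subr_ge0.
apply: (@within_continuous_comp _ _ y _ `[0, T]%classic) => //.
  by move=> s; exact: cvgB cvg_id (cvg_cst _).
by move=> s /=; rewrite !in_itv/= subr_ge0 => /andP[-> sT]; rewrite lerBlDl.
Qed.

Section splice_integral.
Variables (h : 'rV[R]_n -> 'rV[R]_m -> R) (a T : R) (x y : R -> 'rV[R]_n)
  (u v : R -> 'rV[R]_m).
Hypothesis h_cont : continuous (fun p : 'rV[R]_n * 'rV[R]_m => h p.1 p.2).
Hypotheses (a0 : 0 <= a) (T0 : 0 <= T) (yx : y 0 = x a).
Hypotheses (lu : Linf_loc u) (lv : Linf_loc v).
Hypothesis cx : {within `[0, a]%classic, continuous x}.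
Hypothesis cy : {within `[0, T]%classic, continuous y}.

Lemma integrable_splice : mu.-integrable `[0, a + T]%classic
  (EFin \o (fun s => h (splice a x y s) (splice a u v s))).
Proof.
apply: integrable_state_input => //; first exact: Linf_loc_splice.
exact: within_continuous_splice.
Qed.

Lemma Rintegral_splice_le t : t <= a ->
  \int[mu]_(s in `[0, t]%classic) h (splice a x y s) (splice a u v s) =
  \int[mu]_(s in `[0, t]%classic) h (x s) (u s).
Proof.
move=> ta.
(* For [t = a] the spliced input at the right endpoint is [v 0] instead of [u a], so this endpoint
   is dropped on both sides. *)
rewrite -Rintegral_itv_bndo_bndc; last first.
  apply: integrableS integrable_splice => //; apply: subset_itvl.
  by rewrite bnd_simp (le_trans ta)// lerDl.
rewrite -[RHS]Rintegral_itv_bndo_bndc; last first.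
  apply: integrableS (integrable_state_input h_cont lu cx) => //.
  by apply: subset_itvl; rewrite bnd_simp.
apply: eq_Rintegral => s; rewrite inE/= in_itv/= => /andP[_ st].
by rewrite /splice (lt_le_trans st ta).
Qed.

Lemma Rintegral_splice t : 0 <= t <= T ->
  \int[mu]_(s in `[0, a + t]%classic) h (splice a x y s) (splice a u v s) =
  \int[mu]_(s in `[0, a]%classic) h (x s) (u s) +
  \int[mu]_(s in `[0, t]%classic) h (y s) (v s).
Proof.
move=> /andP[t0 tT]; rewrite Rintegral_itv_add//; last first.
  apply: integrableS integrable_splice => //; apply: subset_itvl.
  by rewrite bnd_simp lerD2l.
rewrite Rintegral_splice_le//; congr (_ + _).
apply: eq_Rintegral => s; rewrite inE/= in_itv/= => /andP[s0 _].
by rewrite !splice_shift.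
Qed.

End splice_integral.

Lemma is_sol_splice z u v a T x y : 0 <= a -> 0 <= T ->
  Linf_loc u -> Linf_loc v ->
  is_sol f z u a x -> is_sol f (x a) v T y ->
  is_sol f z (splice a u v) (a + T) (splice a x y).
Proof.
move=> a0 T0 lu lv solx soly.
have yx : y 0 = x a by exact: is_sol0 soly.
have [cx xE] := solx; have [cy yE] := soly.
split=> [|t /andP[t0 taT]]; first exact: within_continuous_splice.
have [ta|/ltW ta] := leP t a.
  rewrite splice_le// xE ?t0//; congr (_ + _); apply/rowP => i; rewrite !mxE.
  by rewrite (Rintegral_splice_le (h := fun w b => f w b ord0 i) (coord_f_cont i) a0 T0).
have ta0 : 0 <= t - a <= T by rewrite subr_ge0 ta lerBlDl.
rewrite -[in LHS](subrK a t) splice_shift; last by case/andP: ta0.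
rewrite yE// xE ?a0 ?lexx// -addrA; congr (_ + _); apply/rowP => i; rewrite !mxE.
rewrite -{2}(subrKC a t).
by rewrite (Rintegral_splice (h := fun w b => f w b ord0 i) (coord_f_cont i)
  a0 T0 yx lu lv cx cy).
Qed.

Lemma admissibleW z T T' u x : T' <= T ->
  admissible f E z T u x -> admissible f E z T' u x.
Proof.
move=> TT' [lu [solx Ex]]; split=> //; split; first exact: is_solW solx.
by move=> t /andP[t0 tT']; apply: Ex; rewrite t0 (le_trans tT').
Qed.

Lemma admissible_shift z T u a x : 0 <= a -> 0 <= T ->
  admissible f E z (a + T) u x ->
  admissible f E (x a) T (fun s => u (s + a)) (fun s => x (s + a)).
Proof.
move=> a0 T0 [lu [solx Ex]]; split; first exact: Linf_loc_shift.
split; first exact: (is_sol_shift a0 T0 lu solx).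
by move=> t /andP[t0 tT]; apply: Ex; rewrite addr_ge0//= addrC lerD2l.
Qed.

Lemma admissible_splice z u v a T x y : 0 <= a -> 0 <= T ->
  admissible f E z a u x -> admissible f E (x a) T v y ->
  admissible f E z (a + T) (splice a u v) (splice a x y).
Proof.
move=> a0 T0 [lu [solx Ex]] [lv [soly Ey]].
split; first exact: Linf_loc_splice.
split; first exact: is_sol_splice.
move=> t /andP[t0 taT]; rewrite /splice; case: ltP => [/ltW|] ta.
  by apply: Ex; rewrite t0.
by apply: Ey; rewrite subr_ge0 ta lerBlDl.
Qed.

(** * Costs and value functions *)

Definition cost u x T : R := \int[mu]_(s in `[0, T]%classic) l (x s) (u s).

Lemma integrable_cost z T u x : admissible f E z T u x ->
  mu.-integrable `[0, T]%classic (EFin \o (fun s => l (x s) (u s))).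
Proof. by move=> [lu [[cx _] _]]; exact: integrable_state_input. Qed.

(** Integrability makes the cost of an admissible trajectory finite, so that later estimates can be
    carried out in [R]. *)
Lemma JT_cost z T u x : admissible f E z T u x -> JT l T u x = (cost u x T)%:E.
Proof.
move=> /integrable_cost il.
by rewrite /cost /Rintegral fineK//; exact: integrable_fin_num.
Qed.

Lemma cost_ge0 T u x : 0 <= cost u x T.
Proof. exact: Rintegral_ge0. Qed.

Lemma cost_shift z a T u x : 0 <= a -> 0 <= T -> admissible f E z (a + T) u x ->
  cost u x (a + T) = cost u x a + cost (fun s => u (s + a)) (fun s => x (s + a)) T.
Proof. by move=> a0 T0 /integrable_cost; exact: Rintegral_itv_add. Qed.

Lemma VT_le_cost z T u x : admissible f E z T u x ->
  (VT f E l T z <= (cost u x T)%:E)%E.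
Proof. by move=> ax; apply: ereal_inf_lbound; exists u, x; rewrite (JT_cost ax). Qed.

(** One half of dynamic programming: every admissible continuation from [x a] can be appended to the
    given initial piece. Without a continuation the right-hand side is [+oo]. *)
Lemma VT_le_splice z u a T x : 0 <= a -> 0 <= T -> admissible f E z a u x ->
  (VT f E l (a + T) z <= (cost u x a)%:E + VT f E l T (x a))%E.
Proof.
move=> a0 T0 ax; rewrite -leeBlDl//; apply: le_ereal_inf_tmp => _ [v [y [ay ->]]].
rewrite leeBlDl// (JT_cost ay) -EFinD.
have [lu [[cx _] _]] := ax; have [lv [soly _]] := ay.
rewrite -(Rintegral_splice l_cont a0 T0 (is_sol0 T0 soly) lu lv cx soly.1) ?T0 ?lexx//.
by apply: VT_le_cost; exact: admissible_splice ay.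
Qed.

Lemma VT_le_Vinf z T : (VT f E l T z <= Vinf f E l z)%E.
Proof.
apply: le_ereal_inf_tmp => _ [u [x [[lu [solx Ex]] ->]]].
have ax T' : admissible f E z T' u x.
  (* Infinite-horizon admissibility provides solutions on positive horizons only; other horizons are
     reached by restriction. *)
  apply: (@admissibleW _ (Num.max 1 T')); first by rewrite le_max lexx orbT.
  split=> //; split; first by apply: solx; rewrite lt_max ltr01.
  by move=> t /andP[t0 _]; exact: Ex.
apply: (@le_trans _ _ (JT l T u x)); first by rewrite (JT_cost (ax T)) VT_le_cost.
apply: ge0_subset_integral => //; last 2 first.
- by move=> s _; rewrite lee_fin.
- exact: subset_itvl.
apply/measurable_EFinP.
rewrite (_ : `[0, +oo[%classic = \bigcup_k `[0, k%:R]%classic); last first.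
  apply/seteqP; split=> [s /=|s [k _]] /=; rewrite !in_itv/= ?andbT; last by case/andP.
  move=> s0; exists (Num.truncn s).+1 => //=; rewrite in_itv/= s0/=.
  by rewrite ltW// truncnS_gt.
apply/measurable_fun_bigcup => // k.
have [_ [[cx _] _]] := ax k%:R; exact: measurable_fun_state_input.
Qed.

End trajectories.

(** * Decay of the remaining optimal cost *)

(** Otherwise [g] minus its mean would be positive on the whole interval with integral zero, hence
    zero almost everywhere, although the interval has positive measure. *)
Lemma exists_le_mean {R : realType} (d : R) (g : R -> R) : 0 < d ->
  (@lebesgue_measure R).-integrable `[0, d]%classic (EFin \o g) ->
  exists2 s, 0 <= s <= d &
    g s * d <= \int[lebesgue_measure]_(t in `[0, d]%classic) g t.
Proof.
move=> d0 ig; apply: contrapT => no_s.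
pose I := \int[lebesgue_measure]_(t in `[0, d]%classic) g t.
have gt_mean s : `[0, d]%classic s -> 0 < g s - I / d.
  rewrite /= in_itv/= => sd; rewrite subr_gt0 ltr_pdivrMr// ltNge.
  by apply/negP => gI; apply: no_s; exists s.
have mu_d : lebesgue_measure (`[0, d]%classic : set R) = d%:E.
  by rewrite lebesgue_measure_itv/= lte_fin d0 oppr0 adde0.
have icst : (@lebesgue_measure R).-integrable `[0, d]%classic (EFin \o cst (I / d)).
  apply: measurable_bounded_integrable => //; first by move: (ltry d); rewrite -mu_d.
  by exists `|I / d|; split=> [|M /ltW ? ? _ //]; exact: num_real.
have ih : (@lebesgue_measure R).-integrable `[0, d]%classic
    (EFin \o (fun s => g s - I / d)).
  exact: integrableB ig icst.
have Ih0 : \int[lebesgue_measure]_(t in `[0, d]%classic) (g t - I / d) = 0.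
  rewrite RintegralB// Rintegral_cst//= mu_d/= divfK ?gt_eqF//.
  exact: subrr.
have [+ _] := ae_eq_integral_abs (@lebesgue_measure R) (measurable_itv `[0, d])
  (measurable_int _ ih).
case=> [|N [mN N0 HN]].
  transitivity (\int[lebesgue_measure]_(t in `[0, d]%classic) (g t - I / d))%:E;
    last by rewrite Ih0.
  rewrite /Rintegral fineK; last exact: integrable_fin_num ih.
  by apply: eq_integral => s; rewrite inE => /gt_mean/ltW gs; rewrite /= ger0_norm.
have : (lebesgue_measure (`[0%R, d]%classic : set R) <= lebesgue_measure N)%E.
  apply: le_measure; rewrite ?inE// => s ds; apply: HN => /= /(_ ds) [].
  by move/eqP; rewrite gt_eqF// gt_mean.
by rewrite mu_d N0 lee_fin leNgt d0.
Qed.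

Section optimal_tail.
Set Implicit Arguments.
Unset Strict Implicit.
Context {R : realType} {n m : nat}.
Variables (f : 'rV[R]_n -> 'rV[R]_m -> 'rV[R]_n) (E : 'rV[R]_n -> 'rV[R]_m -> Prop)
  (l : 'rV[R]_n -> 'rV[R]_m -> R).
Hypothesis f_cont : continuous (fun p : 'rV[R]_n * 'rV[R]_m => f p.1 p.2).
Hypothesis l_cont : continuous (fun p : 'rV[R]_n * 'rV[R]_m => l p.1 p.2).
Hypothesis l_ge0 : forall y v, 0 <= l y v.

Lemma lstar_le y v : E y v -> lstar E l y <= l y v.
Proof.
by move=> Eyv; apply: ge_inf; [exists 0 => _ [w _ <-]|exists v].
Qed.

Lemma lstar_ge0 y : Xset E y -> 0 <= lstar E l y.
Proof.
move=> [v Eyv]; apply: lb_le_inf; first by exists (l y v), v.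
by move=> _ [w _ <-].
Qed.

Variables (z : 'rV[R]_n) (T : R) (u : R -> 'rV[R]_m) (x : R -> 'rV[R]_n).
Hypothesis ax : admissible f E z T u x.
Local Notation P := (cost l u x).

Lemma cost0 : P 0 = 0.
Proof. by rewrite /cost set_itv1 Rintegral_set1. Qed.

Lemma le_cost a b : 0 <= a -> a <= b -> b <= T -> P a <= P b.
Proof.
move=> a0 ab bT; rewrite -(subrKC a b).
rewrite (@cost_shift _ _ _ f E l _ z)// ?subr_ge0//.
  by rewrite lerDl cost_ge0.
by rewrite subrKC; exact: admissibleW ax.
Qed.

Lemma exists_le_mean_cost a d : 0 <= a -> 0 < d -> a + d <= T ->
  exists2 s, a <= s <= a + d & l (x s) (u s) * d <= P (a + d) - P a.
Proof.
move=> a0 d0 adT; have axd := admissibleW adT ax.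
have [|s /andP[s0 sd] Hs] := @exists_le_mean R d (fun s => l (x (s + a)) (u (s + a))) d0.
  exact: integrable_cost (admissible_shift f_cont a0 (ltW d0) axd).
exists (s + a); first by rewrite lerDr s0 addrC lerD2l.
by rewrite (cost_shift l_cont a0 (ltW d0) axd) addrAC subrr add0r.
Qed.

(** Principle of optimality: leaving the optimal trajectory at time [t] and finishing at cost [c]
    cannot beat the optimum. *)
Lemma optimal_tail_le t c : VT f E l T z = (P T)%:E -> 0 <= t <= T ->
  (VT f E l (T - t) (x t) <= c%:E)%E -> P T <= P t + c.
Proof.
move=> opt /andP[t0 tT] Vc; rewrite -lee_fin -opt EFinD -{1}(subrKC t T).
apply: le_trans (leeD2l _ Vc).
by apply: VT_le_splice => //; rewrite ?subr_ge0//; exact: admissibleW ax.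
Qed.

Lemma cost_tail_decay beta delta : 0 < beta -> 0 < delta ->
  (forall t, 0 <= t <= T -> P T - P t <= beta * l (x t) (u t)) ->
  forall k, k%:R * delta <= T ->
  P T - P (k%:R * delta) <= (beta / (beta + delta)) ^+ k * P T.
Proof.
move=> beta0 delta0 tail_le; elim=> [_|k IH kT].
  by rewrite mul0r cost0 subr0 expr0 mul1r.
have kE : k.+1%:R * delta = k%:R * delta + delta.
  by rewrite -addn1 natrD mulrDl mul1r.
have kd0 : 0 <= k%:R * delta by rewrite mulr_ge0 ?ler0n ?ltW.
rewrite kE in kT *.
have bd0 : 0 < beta + delta by rewrite addr_gt0.
have {}IH : P T - P (k%:R * delta) <= (beta / (beta + delta)) ^+ k * P T.
  by apply: IH; apply: le_trans kT; rewrite lerDl ltW.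
have [s /andP[ks sk] Hs] := exists_le_mean_cost kd0 delta0 kT.
have s0 := le_trans kd0 ks.
have {}tail_le := tail_le s (introT andP (conj s0 (le_trans sk kT))).
have Psk := le_cost s0 sk kT.
rewrite exprS -mulrA.
apply: (@le_trans _ _ (beta / (beta + delta) * (P T - P (k%:R * delta)))).
  rewrite mulrAC ler_pdivlMr//.
  (* With [B t = P T - P t], the three scaled bounds give [delta * B((k+1) delta) <= delta * B s <=
     delta * beta * l <= beta * (B(k delta) - B((k+1) delta))], where [l] is the running cost at
     [s]. *)
  have := ler_wpM2l (ltW beta0) Hs.
  have := ler_wpM2l (ltW delta0) tail_le.
  have := ler_wpM2l (ltW delta0) Psk.
  lra.
by rewrite ler_wpM2l// divr_ge0// ltW.
Qed.

End optimal_tail.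

(** * Relaxed dynamic programming inequality *)

Theorem theorem1 (R : realType) (n m : nat)
  (f : 'rV[R]_n -> 'rV[R]_m -> 'rV[R]_n)
  (E : 'rV[R]_n -> 'rV[R]_m -> Prop)
  (l : 'rV[R]_n -> 'rV[R]_m -> R)
  (xbar : 'rV[R]_n) (ubar : 'rV[R]_m)
  (* f continuous, locally Lipschitz in x on R^n \ {0} *)
  (hf_cont : continuous (fun p : 'rV[R]_n * 'rV[R]_m => f p.1 p.2))
  (hf_lip : forall (x0 : 'rV[R]_n) (u0 : 'rV[R]_m), x0 != 0 ->
     exists r L : R, 0 < r /\
       forall y z v, `|y - x0| < r -> `|z - x0| < r -> `|v - u0| < r ->
         `|f y v - f z v| <= L * `|y - z|)
  (* standing assumption: solutions are unique *)
  (huniq : forall x0 u T x1 x2, Linf_loc u -> is_sol f x0 u T x1 ->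
     is_sol f x0 u T x2 -> forall t, 0 <= t <= T -> x1 t = x2 t)
  (* stage cost *)
  (hl_cont : continuous (fun p : 'rV[R]_n * 'rV[R]_m => l p.1 p.2))
  (hl_ge0 : forall x u, 0 <= l x u)
  (* controlled equilibrium *)
  (heq : E xbar ubar /\ f xbar ubar = 0)
  (* standing assumption: existence of minimisers *)
  (hmin : forall (T : R) (x0 : 'rV[R]_n), 0 < T ->
     (exists u x, admissible f E x0 T u x) ->
     exists u x, admissible f E x0 T u x /\ JT l T u x = VT f E l T x0)
  (C : R) (hC : 0 < C)
  (* (A1) *)
  (etal etau : R -> R) (hKl : Kinf etal) (hKu : Kinf etau)
  (hA1 : forall x, Xset E x ->
     etal `|x - xbar| <= lstar E l x <= etau `|x - xbar|)
  (* (A2) *)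
  (gamma : R) (Nb : set 'rV[R]_n) (hgamma : 0 < gamma) (hNb : nbhs xbar Nb)
  (hA2 : forall x, Nb x -> Xset E x ->
     (Vinf f E l x <= (gamma * lstar E l x)%:E)%E) :
  let M := inf [set lstar E l x | x in Xset E `\` Nb] in
  let beta := Num.max (C / M) gamma in
  forall (delta : R), 0 < delta < beta ->
  forall (N : nat), (1 <= N)%N ->
  let T := N%:R * delta in
  (* (A3) *)
  forall (Cbar : R), 0 < Cbar ->
  (forall d' : R, 0 < d' <= T -> forall xh, Xset E xh ->
     (VT f E l T xh <= C%:E)%E ->
     ((d' * lstar E l xh)%:E <= Cbar%:E * VT f E l d' xh)%E) ->
  Num.max (C / (M * delta)) (Cbar * (beta / delta) ^+ 2)
    * (beta / (beta + delta)) ^+ N.-1 < 1 ->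
  let alpha := Cbar * (beta / delta) ^+ 2 * (beta / (beta + delta)) ^+ N.-1 in
  forall (xh : 'rV[R]_n), Xset E xh -> (VT f E l T xh <= C%:E)%E ->
  forall (us : R -> 'rV[R]_m) (xs : R -> 'rV[R]_n),
    admissible f E xh T us xs -> JT l T us xs = VT f E l T xh ->
    (VT f E l T (xs delta) <=
       VT f E l T xh - (1 - alpha)%:E * JT l delta us xs)%E.
Proof.
move=> M beta delta /andP[delta0 delta_beta] N N0 T Cbar Cbar0 hA3 hrate alpha
  xh Xxh VTC us xs ax opt.
have [lu [solx Ex]] := ax.
pose P := cost l us xs.
have hT0 : 0 < T by rewrite mulr_gt0// ltr0n.
have delta_T : delta <= T by rewrite ler_peMl ?ler1n// ltW.
have axW t : t <= T -> admissible f E xh t us xs by move=> tT; exact: admissibleW ax.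
have xs0 : xs 0 = xh by exact: is_sol0 (ltW hT0) solx.
have P0 : P 0 = 0 by exact: cost0.
have Xxs t : 0 <= t <= T -> Xset E (xs t) by move=> /Ex; exists (us t).
have VTE : VT f E l T xh = (P T)%:E by rewrite -opt (JT_cost hl_cont ax).
have PTC : P T <= C by rewrite -lee_fin -VTE.
have PT0 : 0 <= P T by exact: cost_ge0.
have beta0 : 0 < beta by exact: lt_trans delta_beta.
have gamma_beta : gamma <= beta by rewrite le_max lexx orbT.
(* Points outside [Nb] keep a distance [r] from [xbar], so [etal r] bounds [M] from below. The point
   [y] makes the infimum proper; if there is none, [M = 0] and [C / M = 0], which matches the
   convention that [M] is infinite. *)
have out_Nb y : Xset E y -> ~ Nb y -> 0 < M <= lstar E l y.
  move=> Xy nNby.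
  have [_/posnumP[r] rNb] := (nbhs_ballP _ _).1 hNb.
  have etal_r : 0 < etal r%:num by rewrite -hKl.2.1 hKl.2.2.1.
  apply/andP; split; last first.
    apply: ge_inf; last by exists y.
    by exists 0 => _ [w [Xw _] <-]; exact: lstar_ge0.
  apply: (lt_le_trans etal_r); apply: lb_le_inf; first by exists (lstar E l y), y.
  move=> _ [w [Xw nNbw] <-]; have /andP[+ _] := hA1 w Xw; apply: le_trans.
  have rw : r%:num <= `|w - xbar|.
    rewrite leNgt; apply/negP => wr; apply: nNbw; apply: rNb.
    by rewrite -ball_normE /ball_/= distrC.
  move: rw; rewrite le_eqVlt => /predU1P[->//|/hKl.2.2.1 H].
  by apply/ltW/H.
(* The horizon [S] is left free: it is [T - t] for the tail estimate, but longer than that in the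
   final construction. *)
have VT_Nb S t : 0 <= t <= T -> Nb (xs t) ->
    (VT f E l S (xs t) <= (gamma * lstar E l (xs t))%:E)%E.
  move=> tT Nbt; apply: le_trans (hA2 _ Nbt (Xxs _ tT)).
  exact: VT_le_Vinf.
have tail_lstar t : 0 <= t <= T -> P T - P t <= beta * lstar E l (xs t).
  move=> tT; have ls0 := lstar_ge0 hl_ge0 (Xxs _ tT).
  have [Nbt|nNbt] := pselect (Nb (xs t)).
    rewrite lerBlDl.
    apply: le_trans (optimal_tail_le hf_cont hl_cont ax VTE tT (VT_Nb _ _ tT Nbt)) _.
    by rewrite lerD2l ler_wpM2r.
  have /andP[M0 Ml] := out_Nb _ (Xxs _ tT) nNbt.
  apply: (@le_trans _ _ C).
    by apply: le_trans PTC; rewrite gerBl cost_ge0.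
  rewrite -[leLHS](divfK (lt0r_neq0 M0)).
  apply: ler_pM => //; first by rewrite divr_ge0// ltW.
    exact: ltW.
  by rewrite le_max lexx.
have tail_l t : 0 <= t <= T -> P T - P t <= beta * l (xs t) (us t).
  move=> tT; apply: le_trans (tail_lstar t tT) _.
  by apply: ler_wpM2l; [exact: ltW|apply: (lstar_le hl_ge0); exact: Ex].
have lstar_xh : delta * lstar E l xh <= Cbar * P delta.
  rewrite -lee_fin EFinM; apply: le_trans (hA3 delta _ xh Xxh VTC) _.
    by rewrite delta0.
  rewrite EFinM lee_pmul2l// ?lte_fin//.
  by apply: VT_le_cost (axW _ delta_T).
have PT_lstar : P T <= beta * lstar E l xh.
  by have := tail_lstar 0; rewrite lexx ltW// P0 subr0 xs0; exact.
(* The tail estimate at time 0 bounds [P T] by [beta * lstar(xh)], and (A3) with [d' = delta] bounds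
   [delta * lstar(xh)] by the cost of the first interval. *)
have PT_delta : delta * P T <= beta * Cbar * P delta.
  apply: (@le_trans _ _ (beta * (delta * lstar E l xh))).
    by rewrite mulrCA ler_wpM2l// ltW.
  by rewrite -mulrA ler_wpM2l// ltW.
rewrite VTE (JT_cost hl_cont (axW _ delta_T)) -EFinM -EFinB.
rewrite -/(P delta).
have [N1|N2] : N = 1%N \/ (1 < N)%N.
  by case: (N) N0 => [//|[|k]]; [left|right].
(* For N = 1 the time s may precede delta. But then (A3) and the rate condition are compatible
   only if the optimal cost vanishes, in which case the trajectory ends in xbar. *)
- have TE : T = delta by rewrite /T N1 mul1r.
  have rate : Cbar * (beta / delta) ^+ 2 < 1.
    apply: le_lt_trans hrate; rewrite N1 expr0 mulr1.
    by rewrite le_max lexx orbT.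
  have PT_eq0 : P T = 0.
    apply/eqP; rewrite eq_le PT0 andbT leNgt; apply/negP => PT_gt0.
    (* Cancelling [P T] leaves [delta <= beta * Cbar]; together with [delta < beta] this forces
       [Cbar * (beta / delta)^2 >= 1]. *)
    move: PT_delta; rewrite -TE ler_pM2r// TE => delta_le.
    move: rate; apply/negP; rewrite -leNgt.
    have -> : Cbar * (beta / delta) ^+ 2 = beta * Cbar / delta * (beta / delta).
      by field; exact: lt0r_neq0.
    by rewrite mulr_ege1// ler_pdivlMr// mul1r// ltW.
  (* Every interval [[T - d, T]] contains a time of nonpositive running cost, where (A1) puts the
     state at [xbar]. By continuity the endpoint is [xbar] too: the ball of radius [|xs T - xbar|]
     around [xs T] misses [xbar]. *)
  have xsT : xs T = xbar.
    apply/eqP; rewrite -subr_eq0 -normr_eq0 eq_le normr_ge0 andbT leNgt.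
    apply/negP => e0.
    have TT : `[0, T]%classic T by rewrite /= in_itv/= lexx ltW.
    have /nbhs_ballP[r /= r0 rT] : nbhs T [set s | `[0, T]%classic s ->
        ball (xs T) `|xs T - xbar| (xs s)].
      exact: ((subspace_continuousP _ _).1 solx.1 T TT _ (nbhsx_ballx _ _ e0)).
    pose d := Num.min (r / 2) T.
    have d0 : 0 < d by rewrite lt_min hT0 divr_gt0.
    have dT : d <= T by rewrite ge_min lexx orbT.
    have dr : d < r.
      by rewrite gt_min ltr_pdivrMr// ltr_pMr// ltr1n.
    have [||s /andP[ds sT] Hs] := exists_le_mean_cost hf_cont hl_cont ax (a := T - d) _ d0.
    - by rewrite subr_ge0.
    - by rewrite subrK.
    rewrite subrK in sT Hs.
    have sT' : 0 <= s <= T by rewrite sT andbT (le_trans _ ds)// subr_ge0.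
    have ls0 : lstar E l (xs s) <= 0.
      apply: le_trans (lstar_le hl_ge0 (Ex _ sT')) _.
      rewrite -(pmulr_lle0 _ d0); apply: le_trans Hs _.
      by rewrite -/P PT_eq0 sub0r oppr_le0 cost_ge0.
    have xs_s : xs s = xbar.
      apply/eqP; rewrite -subr_eq0 -normr_eq0 eq_le normr_ge0 andbT leNgt.
      apply/negP => /(hKl.2.2.1 _ _ (lexx 0)); rewrite hKl.2.1 ltNge => /negP; apply.
      by have /andP[+ _] := hA1 _ (Xxs _ sT'); move/le_trans; apply.
    have : ball (xs T) `|xs T - xbar| (xs s).
      apply: rT; last by rewrite /= in_itv.
      rewrite -ball_normE /ball_/= ger0_norm ?subr_ge0//.
      by rewrite (le_lt_trans _ dr)// lerBlDl -lerBlDr.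
    by rewrite -ball_normE /ball_/= xs_s ltxx.
  (* The upper bound in (A1) makes [lstar] vanish at the equilibrium, so (A2) gives [Vinf] at most 0
     there. *)
  have lstar0 : lstar E l xbar <= 0.
    have /hA1/andP[_] : Xset E xbar by exists ubar; exact: heq.1.
    by rewrite subrr normr0 hKu.2.1.
  rewrite -TE PT_eq0 mulr0 subr0 xsT; apply: (@le_trans _ _ (Vinf f E l xbar)).
    exact: VT_le_Vinf.
  apply: le_trans (hA2 _ (nbhs_singleton hNb) _) _; first by exists ubar; exact: heq.1.
  by rewrite lee_fin mulr_ge0_le0// ltW.
have TE : T = N.-1%:R * delta + delta.
  by rewrite /T -[in LHS](prednK N0) -addn1 natrD mulrDl mul1r.
(* This is where [N >= 2] enters: the last interval starts no earlier than [delta], and hence so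
   does the time [s] chosen in it. *)
have delta_pred : delta <= N.-1%:R * delta.
  by apply: ler_peMl; [exact: ltW|rewrite ler1n -ltnS prednK].
have pred_T : N.-1%:R * delta <= T by rewrite TE lerDl ltW.
set rho := beta / (beta + delta) in hrate alpha *.
have rho0 : 0 <= rho by rewrite divr_ge0 ?addr_ge0 ?ltW.
have decay := cost_tail_decay hf_cont hl_cont hl_ge0 ax beta0 delta0 tail_l pred_T.
have [|s /andP[ps sT] Hs] :=
  exists_le_mean_cost hf_cont hl_cont ax (le_trans (ltW delta0) delta_pred) delta0.
  by rewrite TE.
rewrite -TE in sT Hs.
have ds : delta <= s by exact: le_trans ps.
have s0 : 0 <= s by exact: le_trans (ltW delta0) ds.
have sT' : 0 <= s <= T by rewrite s0.
have ls : lstar E l (xs s) * delta <= rho ^+ N.-1 * P T.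
  apply: le_trans decay; apply: le_trans Hs.
  by apply: ler_wpM2r; [exact: ltW|apply: (lstar_le hl_ge0); exact: Ex].
(* Outside [Nb] one would have [M * delta <= rho^(N-1) * C], against the first term of the maximum
   in the rate condition. *)
have Nbs : Nb (xs s).
  apply: contrapT => /(out_Nb _ (Xxs _ sT')) /andP[M0 Ml].
  move: hrate; apply/negP; rewrite -leNgt.
  apply: (@le_trans _ _ (C / (M * delta) * rho ^+ N.-1)); last first.
    by apply: ler_wpM2r; [exact: exprn_ge0|rewrite le_max lexx].
  rewrite mulrAC ler_pdivlMr ?mulr_gt0// mul1r.
  apply: (@le_trans _ _ (lstar E l (xs s) * delta)).
    by apply: ler_wpM2r => //; exact: ltW.
  apply: le_trans ls _.
  by rewrite mulrC; apply: ler_wpM2r => //; exact: exprn_ge0.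
(* Following the optimal trajectory from [delta] to [s] uses [s - delta] of the new horizon [T]; the
   remaining [T - (s - delta)] is spent inside the reach of (A2). *)
have VTs : (VT f E l T (xs delta) <= (P s - P delta + gamma * lstar E l (xs s))%:E)%E.
  have sd0 : 0 <= s - delta by rewrite subr_ge0.
  have axs : admissible f E xh (delta + (s - delta)) us xs.
    by rewrite subrKC; exact: axW.
  have := VT_le_splice hf_cont hl_cont sd0 (T := T - (s - delta)) _
    (admissible_shift hf_cont (ltW delta0) sd0 axs).
  rewrite subrKC subrK => VTs; apply: le_trans (VTs _) _.
    by rewrite subr_ge0 (le_trans _ sT)// gerBl ltW.
  have -> : P s = P delta + cost l (fun t => us (t + delta))
      (fun t => xs (t + delta)) (s - delta).
    by rewrite -(cost_shift hl_cont (ltW delta0) sd0 axs) subrKC.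
  rewrite [P delta + _]addrC addrK EFinD leeD2l//.
  exact: VT_Nb.
apply: le_trans VTs _; rewrite lee_fin.
have PsT : P s <= P T by exact: (le_cost hl_cont hl_ge0 ax).
suff : gamma * lstar E l (xs s) <= alpha * P delta by lra.
apply: (@le_trans _ _ (beta * lstar E l (xs s))).
  by apply: ler_wpM2r => //; exact: lstar_ge0 (Xxs _ sT').
(* The factor [delta^2] clears the two quotients [beta / delta] in [alpha]: one comes from the mean
   estimate at [s], the other from [PT_delta]. *)
rewrite -(ler_pM2r (mulr_gt0 delta0 delta0)).
have -> : alpha * P delta * (delta * delta) = beta * rho ^+ N.-1 * (beta * Cbar * P delta).
  by rewrite /alpha -/rho; field; exact: lt0r_neq0.
apply: (@le_trans _ _ (beta * rho ^+ N.-1 * (delta * P T))).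
  rewrite [leLHS](_ : _ = beta * delta * (lstar E l (xs s) * delta)); last by ring.
  rewrite [leRHS](_ : _ = beta * delta * (rho ^+ N.-1 * P T)); last by ring.
  by rewrite ler_pM2l// mulr_gt0.
by apply: ler_wpM2l => //; rewrite mulr_ge0 ?exprn_ge0// ltW.
Qed.
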